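(* A (finite, connected) square grid graph is $F$-avoiding if and only if it is $12$-representable.
   Context: The grid graph is the infinite graph with vertex set $\mathbb{Z}^2$ in which two vertices are adjacent iff they are at Euclidean distance $1$. A square of an induced subgraph $H$ of the grid graph is a set of four vertices of $H$ of the form $\{(x,y),(x+1,y),(x,y+1),(x+1,y+1)\}$ (inducing a $4$-cycle). A square grid graph is a finite connected induced subgraph of the grid graph that consists of squares, i.e. every vertex and every edge of it lies in some square of it. A labeled graph is a graph whose vertices are distinct positive integers. A word $w$ over positive integers with set of letters $A(w)$, and for $B\subseteq A(w)$, $w_B$ denotes the subword of $w$ consisting of the letters in $B$. A labeled graph $G=(V,E)$ is $12$-representable if there is a word $w$ with $A(w)=V$ such that for all distinct $x,y\in V$: $xy\notin E$ if and only if $w_{\{x,y\}}$ contains an occurrence of the pattern $12$, i.e. some occurrence of $\min(x,y)$ precedes some occurrence of $\max(x,y)$ in $w$; such $w$ is called a ($12$-)representant of $G$. An unlabeled graph is $12$-representable if it admits a labeling (injective assignment of positive integers to vertices) making the resulting labeled graph $12$-representable. Let $X$ be the graph with vertices $a,b,c,d,e,f,g,h,i$ and edges $ab, bc, cd, de, ef, fc, bg, gf, gh, hi, if$ (equivalently, the induced subgraph of the grid on $b=(0,0),c=(0,1),d=(0,2),e=(1,2),f=(1,1),g=(1,0),h=(2,0),i=(2,1),a=(-1,0)$: three squares in an L-shape plus a pendant edge $ab$). Let $C_m$ denote the cycle graph on $m$ vertices, and $F=\{X\}\cup\{C_{2n}: n\ge 4\}$. A graph is $F$-avoiding if it contains no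 induced subgraph isomorphic to a member of $F$. *)

(* Defs.v *)
From HB Require Import structures.
From mathcomp Require Import all_boot all_order all_algebra finmap.

Set Implicit Arguments.
Unset Strict Implicit.
Unset Printing Implicit Defensive.

Import GRing.Theory.

Record sgraph := SGraph {
  svertex :> finType;
  sedge : rel svertex;
  sedge_sym : symmetric sedge;
  sedge_irrefl : irreflexive sedge
}.

Definition isomorphic (G H : sgraph) : Prop :=
  exists2 f : G -> H, bijective f & forall x y, sedge (f x) (f y) = sedge x y.

Section Induced.
Variables (G : sgraph) (S : {set G}).

Definition induced_edge : rel {x : G | x \in S} :=
  fun x y => sedge (val x) (val y).

Lemma induced_edge_sym : symmetric induced_edge.
Proof. by move=> x y; apply: sedge_sym. Qed.

Lemma induced_edge_irrefl : irreflexive induced_edge.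
Proof. by move=> x; apply: sedge_irrefl. Qed.

Definition induced : sgraph := SGraph induced_edge_sym induced_edge_irrefl.
End Induced.

Definition connected (G : sgraph) : Prop :=
  forall x y : G, connect (@sedge G) x y.

(* A graph family is a predicate on graphs; it need not be closed under
   isomorphism. *)
Definition avoiding (F : sgraph -> Prop) (G : sgraph) : Prop :=
  forall H : sgraph, F H -> ~ exists S : {set G}, isomorphic (induced S) H.

Section Cycle.
Variable m : nat.

(* The conjunct [i != j] only matters for m = 1, where [ordS] is the identity. *)
Definition cycle_edge : rel 'I_m :=
  fun i j => (i != j) && ((ordS i == j) || (ordS j == i)).

Lemma cycle_edge_sym : symmetric cycle_edge.
Proof. by move=> i j; rewrite /cycle_edge eq_sym orbC. Qed.

Lemma cycle_edge_irrefl : irreflexive cycle_edge.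
Proof. by move=> i; rewrite /cycle_edge eqxx. Qed.

Definition cycle_graph : sgraph := SGraph cycle_edge_sym cycle_edge_irrefl.
End Cycle.

(* The vertices a, b, ..., i are numbered 0, 1, ..., 8; the edges are
   ab, bc, cd, de, ef, fc, bg, gf, gh, hi, if. *)
Definition X_edges : seq (nat * nat) :=
  [:: (0, 1); (1, 2); (2, 3); (3, 4); (4, 5); (5, 2);
      (1, 6); (6, 5); (6, 7); (7, 8); (8, 5)].

Definition X_edge : rel 'I_9 :=
  fun x y => ((val x, val y) \in X_edges) || ((val y, val x) \in X_edges).

Lemma X_edge_sym : symmetric X_edge.
Proof. by move=> x y; rewrite /X_edge orbC. Qed.

Lemma X_edge_irrefl : irreflexive X_edge.
Proof. by case; do 9 (case=> [//|]). Qed.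

Definition X_graph : sgraph := SGraph X_edge_sym X_edge_irrefl.

Definition F_family (H : sgraph) : Prop :=
  H = X_graph \/ exists2 n : nat, 4 <= n & H = cycle_graph (2 * n).

Definition subword (w : seq nat) (B : pred nat) : seq nat :=
  [seq x <- w | B x].

Definition contains12 (w : seq nat) : Prop :=
  exists i j : nat, [/\ i < j, j < size w & nth 0 w i < nth 0 w j].

(* A labeled graph is given as a graph G with a labeling l; its vertex set is
   then the set [codom l] of labels. *)
Definition labeling (G : sgraph) (l : G -> nat) : Prop :=
  injective l /\ forall v, 0 < l v.

Definition representant (G : sgraph) (l : G -> nat) (w : seq nat) : Prop :=
  w =i codom l /\
  forall u v : G, u != v ->
    (~~ sedge u v <-> contains12 (subword w (pred2 (l u) (l v)))).

Definition labeled_representable12 (G : sgraph) (l : G -> nat) : Prop :=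
  exists w : seq nat, representant l w.

Definition representable12 (G : sgraph) : Prop :=
  exists2 l : G -> nat, labeling l & labeled_representable12 l.

Local Open Scope fset_scope.
Local Open Scope ring_scope.

(* Euclidean distance 1, expressed by its square to stay within the integers. *)
Definition grid_adj : rel (int * int) :=
  fun p q => (p.1 - q.1) ^+ 2 + (p.2 - q.2) ^+ 2 == 1.

Lemma grid_adj_sym : symmetric grid_adj.
Proof.
by move=> p q; rewrite /grid_adj -sqrrN opprB -[(p.2 - _) ^+ 2]sqrrN opprB.
Qed.

Lemma grid_adj_irrefl : irreflexive grid_adj.
Proof. by move=> p; rewrite /grid_adj !subrr. Qed.

Section GridGraph.
Variable V : {fset int * int}.

Definition grid_edge : rel V := fun u v => grid_adj (val u) (val v).

Lemma grid_edge_sym : symmetric grid_edge.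
Proof. by move=> u v; apply: grid_adj_sym. Qed.

Lemma grid_edge_irrefl : irreflexive grid_edge.
Proof. by move=> u; apply: grid_adj_irrefl. Qed.

Definition grid_graph : sgraph := SGraph grid_edge_sym grid_edge_irrefl.
End GridGraph.

Definition unit_square (p : int * int) : {fset int * int} :=
  [fset p; (p.1 + 1, p.2); (p.1, p.2 + 1); (p.1 + 1, p.2 + 1)].

Definition is_square_of (V Q : {fset int * int}) : Prop :=
  Q `<=` V /\ exists p, Q = unit_square p.

Definition square_grid_graph (V : {fset int * int}) : Prop :=
  [/\ connected (grid_graph V),
      forall u, u \in V -> exists2 Q, is_square_of V Q & u \in Q
    & forall u v, u \in V -> v \in V -> grid_adj u v ->
        exists2 Q, is_square_of V Q & (u \in Q) && (v \in Q)].

(* Main.v *)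
Require Import Defs.
From mathcomp Require Import all_boot all_order all_algebra finmap zify.

Set Implicit Arguments.
Unset Strict Implicit.
Unset Printing Implicit Defensive.

Import GRing.Theory.

(** In a representant, let [F x] and [R x] delimit the occurrences of the letter
    of [x]; then [x], with the smaller label, is adjacent to [y] iff the occurrences
    of [y] all precede those of [x].  So the edges, oriented by increasing label,
    form a strict order, and in a triangle-free graph every vertex is a source or a
    sink.  The resulting two-dimensional dominance model rules out [X] and long
    cycles.

    Conversely, it suffices to enumerate the unit squares (cells) so that every
    vertex lies in consecutive cells: two vertices of different parity are then
    adjacent iff their intervals of cells meet, and a word can be written down.
    Excluding [X] and the 8-cycle around a vertex makes the "link" graph on the
    cells of maximal degree two, so a maximal path contains all cells; it remains to
    see that it does not close up.  This is a statement about [H^1] with coefficients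
    in [bool]: a shortest closed walk of odd weight is an induced cycle, so without
    long induced cycles a cocycle that vanishes on the cells is a coboundary, whereas
    a cyclic sequence of cells carries a nontrivial cocycle. *)

(** * Obstructions to representability *)

Lemma contains12_pred2 (w : seq nat) (x y : nat) :
  x < y -> contains12 (subword w (pred2 x y)) <-> mem2 w x y.
Proof.
move=> xy; have neq : (x == y) = false by lia.
have -> : mem2 w x y = mem2 (subword w (pred2 x y)) x y.
  by rewrite !mem2E neq subseq_filter /= !eqxx orbT.
have in2 z : z \in subword w (pred2 x y) -> z = x \/ z = y.
  by rewrite mem_filter => /andP[/orP[]/eqP-> _]; [left | right].
move: (subword _ _) in2 => s in2; split.
- case=> i [j [ij js lt_ij]].
  have := in2 _ (mem_nth 0 js); have := in2 _ (mem_nth 0 (ltn_trans ij js)).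
  move=> Hi Hj; have [ex ey] : nth 0 s i = x /\ nth 0 s j = y.
    by case: Hi Hj lt_ij => -> [] -> => [||//|]; lia.
  have is_ : i < size s by lia.
  rewrite -(cat_take_drop j s) mem2_cat; apply/orP; right; apply/andP; split.
    by rewrite -ex -(nth_take 0 ij) mem_nth // size_take js.
  by rewrite (drop_nth 0 js) ey mem_head.
- rewrite /mem2 => ys.
  have xs : x \in s.
    by apply: contraLR ys => /memNindex->; rewrite drop_size.
  move: (ys); rewrite -index_mem size_drop => lt.
  exists (index x s), (index x s + index y (drop (index x s) s)).
  have ny : nth 0 s (index x s + index y (drop (index x s) s)) = y.
    by rewrite -nth_drop nth_index.
  split; last by rewrite ny nth_index.
  - rewrite -[X in X < _]addn0 ltn_add2l lt0n; apply/eqP => e0.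
    by move: ny; rewrite e0 addn0 nth_index // => e; rewrite e eqxx in neq.
  - by rewrite -ltn_subRL.
Qed.

(** Reading the word backwards finds last occurrences: [size w - index y (rev w)] is the position
    just after the last [y]. *)
Lemma mem2_index_rev (T : eqType) (w : seq T) (x y : T) :
  y \in w -> mem2 w x y = (index x w < size w - index y (rev w)).
Proof.
move=> yw; rewrite /mem2 -[X in drop _ X]revK drop_rev size_rev mem_rev.
by rewrite in_take ?mem_rev //; lia.
Qed.

Lemma index_lt_index_rev (T : eqType) (w : seq T) (y : T) :
  y \in w -> index y w < size w - index y (rev w).
Proof.
move=> yw; rewrite -mem2_index_rev // /mem2 (drop_nth y) ?index_mem //.
by rewrite nth_index // mem_head.
Qed.

(* [F x] is the position of the first occurrence of the letter [l x] in a
   representant, [R x] the position after the last one. *)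
Definition interval_model (G : sgraph) (l F R : G -> nat) : Prop :=
  [/\ injective l, forall x, F x < R x
    & forall x y, l x < l y -> sedge x y = (R y <= F x)].

(** Some occurrence of [l x] precedes one of [l y] iff the first [l x] comes before the last [l y];
    so for [l x < l y] a nonedge means [F x < R y]. *)
Lemma representable12_model (G : sgraph) :
  representable12 G -> exists l F R : G -> nat, interval_model l F R.
Proof.
case=> l [linj _] [w [wl wE]].
have lw x : l x \in w by rewrite wl codom_f.
exists l, (fun x => index (l x) w), (fun x => size w - index (l x) (rev w)).
split=> // [x|x y lxy]; first exact: index_lt_index_rev.
have xy : x != y by apply: contraTneq lxy => ->; rewrite ltnn.
rewrite leqNgt -mem2_index_rev //; apply: negb_inj; rewrite negbK.
by apply/idP/idP => [/(proj1 (wE _ _ xy))|] /(contains12_pred2 _ lxy);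
  last move/(proj2 (wE _ _ xy)).
Qed.

Lemma model_embedding (G H : sgraph) (f : H -> G) (l F R : G -> nat) :
  injective f -> (forall x y, sedge (f x) (f y) = sedge x y) ->
  interval_model l F R -> interval_model (l \o f) (F \o f) (R \o f).
Proof.
move=> finj fE [linj FR E]; split=> [||x y /=]; first exact: inj_comp.
- by move=> x /=.
- by rewrite -fE; apply: E.
Qed.

Lemma isomorphic_induced_embedding (G H : sgraph) (S : {set G}) :
  isomorphic (induced S) H ->
  exists2 f : H -> G, injective f & forall x y, sedge (f x) (f y) = sedge x y.
Proof.
case=> h [k hk kh] hE; exists (fun x => val (k x)).
- by move=> x y /val_inj e; rewrite -[x]kh -[y]kh e.
- by move=> x y; rewrite -[RHS](f_equal2 (@sedge H) (kh x) (kh y)) hE.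
Qed.

Section ModelObstructions.
Variables (G : sgraph) (l F R : G -> nat).
Hypothesis lFR : interval_model l F R.

Lemma model_edge_ltn x y : sedge x y -> l x < l y \/ l y < l x.
Proof.
case: lFR => linj _ _ xy.
have : l x != l y by rewrite (inj_eq linj); apply: contraTneq xy => ->;
  rewrite sedge_irrefl.
lia.
Qed.

(* Edges oriented by increasing label form a strict order. *)
Lemma model_no_chain x y z :
  sedge x y -> sedge y z -> ~~ sedge x z -> l x < l y -> l z < l y.
Proof.
case: lFR => _ FR E xy yz xz lxy; case: (model_edge_ltn yz) => // lyz.
move: xz; rewrite E; last by lia.
by move: xy yz; rewrite !E // => h1 h2; have := FR y; lia.
Qed.

Lemma model_no_chainV x y z :
  sedge x y -> sedge y z -> ~~ sedge x z -> l y < l x -> l y < l z.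
Proof.
move=> xy yz xz lyx; case: (model_edge_ltn yz) => // lzy.
have := @model_no_chain z y x; rewrite ![sedge z _]sedge_sym [sedge y x]sedge_sym.
by move/(_ yz xy xz lzy) => ?; lia.
Qed.

(* As [u0] has minimal label, its nonneighbors [w3] and [w4] end after [F u0],
   hence [F u0 < F u1, F u2], and the labels of [u1, w1, u2, w2] form a cycle. *)
Lemma model_no_path7 (w4 u1 w1 u0 w2 u2 w3 : G) :
  (forall x, l u0 <= l x) ->
  sedge w4 u1 -> sedge u1 w1 -> sedge w1 u0 ->
  sedge u0 w2 -> sedge w2 u2 -> sedge u2 w3 ->
  ~~ sedge u0 w4 -> ~~ sedge u0 w3 -> ~~ sedge u1 w2 -> ~~ sedge u2 w1 ->
  ~~ sedge u1 u0 -> ~~ sedge u0 u2 -> ~~ sedge w4 w1 -> ~~ sedge w2 w3 -> False.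
Proof.
case: (lFR) => _ FR E min e41 e11 e10 e02 e22 e23 n04 n03 n12 n21 n10 n02 n41 n23.
have l01 : l u0 < l w1 by case: (model_edge_ltn e10) => //; rewrite ltnNge min.
have l02 : l u0 < l w2 by case: (model_edge_ltn e02) => //; rewrite ltnNge min.
have l11 : l u1 < l w1.
  by apply: (@model_no_chain u0 w1 u1); rewrite // sedge_sym.
have l22 : l u2 < l w2 by apply: (@model_no_chain u0 w2 u2).
have l14 : l u1 < l w4.
  by apply: (@model_no_chainV w1 u1 w4); rewrite // sedge_sym.
have l23 : l u2 < l w3 by apply: (@model_no_chainV w2 u2 w3).
move: e41 e11 e10 e02 e22 e23.
rewrite ![sedge w4 _]sedge_sym ![sedge w1 _]sedge_sym ![sedge w2 _]sedge_sym.
rewrite !E // => h41 h11 h10 h02 h22 h23.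
have l04 : l u0 < l w4 by have := min u1; lia.
have l03 : l u0 < l w3 by have := min u2; lia.
move: n04 n03; rewrite !E // => h04 h03.
have h12 : l w2 <= l u1.
  by rewrite leqNgt; apply: contra n12 => lt; rewrite E //; lia.
have h21 : l w1 <= l u2.
  by rewrite leqNgt; apply: contra n21 => lt; rewrite E //; lia.
by have := FR u1; lia.
Qed.

End ModelObstructions.

Lemma cycle_graph_no_model m (l F R : cycle_graph m -> nat) :
  8 <= m -> ~ interval_model l F R.
Proof.
move=> m8 lFR; have m0 : 0 < m by lia.
have [u0 min] : exists u0, forall x, l u0 <= l x.
  case: (@arg_minnP _ (Ordinal m0 : cycle_graph m) xpredT l isT) => u _ h.
  by exists u => x; apply: h.
pose c k : cycle_graph m := Ordinal (ltn_pmod (u0 + k) m0).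
have cE i j : i < m -> j < m ->
  sedge (c i) (c j) = [|| j == i.+1, i == j.+1, (i == 0) && (j == m.-1)
                        | (j == 0) && (i == m.-1)].
  move=> im jm; rewrite /= /cycle_edge /c -!val_eqE /=.
  have u0m := ltn_ord u0.
  have md k : k < m -> (u0 + k) %% m = if u0 + k < m then u0 + k else u0 + k - m.
    move=> km; case: ifP => h; first by rewrite modn_small.
    have e : m <= u0 + k by lia.
    by rewrite -[in LHS](subnK e) modnDr modn_small //; lia.
  have sd k : k < m -> k.+1 %% m = if k.+1 < m then k.+1 else 0.
    move=> km; case: ifP => h; first by rewrite modn_small.
    have -> : k.+1 = m by lia.
    exact: modnn.
  by rewrite !md // !sd; do ?case: ifP; lia.
have c0 : c 0 = u0 by apply: val_inj; rewrite /= addn0 modn_small.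
(* The path makes three steps in either direction from the vertex [u0 = c 0] of minimal label;
   [m - k] stands for the index [- k]. *)
apply: (@model_no_path7 _ l F R lFR
  (c 3) (c 2) (c 1) (c 0) (c (m - 1)) (c (m - 2)) (c (m - 3))).
- by rewrite c0.
all: rewrite cE; lia.
Qed.

(** As labels never increase along two successive edges, the direction of the edge [fc] settles all
    others: [b, d, f, h] are all smaller or all larger than their neighbors. The nonedges
    [fa, bi, be, hc, dg] then close a cycle of strict inequalities. *)
Lemma X_graph_no_model (l F R : X_graph -> nat) : ~ interval_model l F R.
Proof.
move=> lFR; pose v k : X_graph := inord k.
have vE i j : i < 9 -> j < 9 ->
  sedge (v i) (v j) = ((i, j) \in X_edges) || ((j, i) \in X_edges).
  have vv k : k < 9 -> val (v k) = k by move=> k9; apply: inordK.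
  by move=> i9 j9; rewrite /sedge /= /X_edge !vv.
have E i j : i < 9 -> j < 9 -> l (v i) < l (v j) ->
   ((i, j) \in X_edges) || ((j, i) \in X_edges) = (R (v j) <= F (v i)).
  by move=> i9 j9; rewrite -vE //; case: lFR => _ _; apply.
have ch i j k : i < 9 -> j < 9 -> k < 9 ->
  ((i, j) \in X_edges) || ((j, i) \in X_edges) ->
  ((k, j) \in X_edges) || ((j, k) \in X_edges) ->
  ~~ (((i, k) \in X_edges) || ((k, i) \in X_edges)) ->
  l (v i) < l (v j) -> l (v k) < l (v j).
  move=> i9 j9 k9; rewrite -(vE i j) // -(vE k j) // -(vE i k) //.
  rewrite [sedge (v k) _]sedge_sym; exact: (model_no_chain lFR).
have chV i j k : i < 9 -> j < 9 -> k < 9 ->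
  ((i, j) \in X_edges) || ((j, i) \in X_edges) ->
  ((k, j) \in X_edges) || ((j, k) \in X_edges) ->
  ~~ (((i, k) \in X_edges) || ((k, i) \in X_edges)) ->
  l (v j) < l (v i) -> l (v j) < l (v k).
  move=> i9 j9 k9; rewrite -(vE i j) // -(vE k j) // -(vE i k) //.
  rewrite [sedge (v k) _]sedge_sym; exact: (model_no_chainV lFR).
have D i j : i < 9 -> j < 9 -> l (v i) < l (v j) ->
   ((i, j) \in X_edges) || ((j, i) \in X_edges) -> (R (v j) <= F (v i)).
  by move=> i9 j9 lt; rewrite E.
have N i j : i < 9 -> j < 9 ->
   ~~ (((i, j) \in X_edges) || ((j, i) \in X_edges)) ->
   (l (v j) <= l (v i)) || (F (v i) < R (v j)).
  move=> i9 j9 n; case: (leqP (l (v j)) (l (v i))) => //= lt.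
  by move: n; rewrite (E _ _ i9 j9 lt) -ltnNge.
have e52 : sedge (v 5) (v 2) by rewrite vE.
case: (model_edge_ltn lFR e52) => h52.
- have h56 : l (v 5) < l (v 6) by apply: (@chV 2 5 6).
  have h54 : l (v 5) < l (v 4) by apply: (@chV 2 5 4).
  have h58 : l (v 5) < l (v 8) by apply: (@chV 2 5 8).
  have h12 : l (v 1) < l (v 2) by apply: (@ch 5 2 1).
  have h16 : l (v 1) < l (v 6) by apply: (@ch 5 6 1).
  have h10 : l (v 1) < l (v 0) by apply: (@chV 2 1 0).
  have h32 : l (v 3) < l (v 2) by apply: (@ch 5 2 3).
  have h34 : l (v 3) < l (v 4) by apply: (@ch 5 4 3).
  have h76 : l (v 7) < l (v 6) by apply: (@ch 5 6 7).
  have h78 : l (v 7) < l (v 8) by apply: (@ch 5 8 7).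
  have n50 := N 5 0 isT isT isT.
  have n18 := N 1 8 isT isT isT.
  have n14 := N 1 4 isT isT isT.
  have n72 := N 7 2 isT isT isT.
  have n36 := N 3 6 isT isT isT.
  have d52 := D 5 2 isT isT h52 isT.
  have d56 := D 5 6 isT isT h56 isT.
  have d54 := D 5 4 isT isT h54 isT.
  have d58 := D 5 8 isT isT h58 isT.
  have d12 := D 1 2 isT isT h12 isT.
  have d16 := D 1 6 isT isT h16 isT.
  have d10 := D 1 0 isT isT h10 isT.
  have d32 := D 3 2 isT isT h32 isT.
  have d34 := D 3 4 isT isT h34 isT.
  have d76 := D 7 6 isT isT h76 isT.
  have d78 := D 7 8 isT isT h78 isT.
  (* If [l a <= l f], the labels give [g <= d < c <= h < g]. Otherwise [F f < R a], and then
     [R c <= F d < R g <= F h < R c]. The other direction of [fc] is the mirror image. *)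
  move: h52 d52 h56 d56 h54 d54 h58 d58 h12 d12 h16 d16 h10 d10 h32 d32.
  move: h34 d34 h76 d76 h78 d78 n50 n18 n14 n72 n36.
  by clear; move=> *; lia.
- have h56 : l (v 6) < l (v 5) by apply: (@ch 2 5 6).
  have h54 : l (v 4) < l (v 5) by apply: (@ch 2 5 4).
  have h58 : l (v 8) < l (v 5) by apply: (@ch 2 5 8).
  have h12 : l (v 2) < l (v 1) by apply: (@chV 5 2 1).
  have h16 : l (v 6) < l (v 1) by apply: (@chV 5 6 1).
  have h10 : l (v 0) < l (v 1) by apply: (@ch 2 1 0).
  have h32 : l (v 2) < l (v 3) by apply: (@chV 5 2 3).
  have h34 : l (v 4) < l (v 3) by apply: (@chV 5 4 3).
  have h76 : l (v 6) < l (v 7) by apply: (@chV 5 6 7).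
  have h78 : l (v 8) < l (v 7) by apply: (@chV 5 8 7).
  have n50 := N 0 5 isT isT isT.
  have n18 := N 8 1 isT isT isT.
  have n14 := N 4 1 isT isT isT.
  have n72 := N 2 7 isT isT isT.
  have n36 := N 6 3 isT isT isT.
  have d52 := D 2 5 isT isT h52 isT.
  have d56 := D 6 5 isT isT h56 isT.
  have d54 := D 4 5 isT isT h54 isT.
  have d58 := D 8 5 isT isT h58 isT.
  have d12 := D 2 1 isT isT h12 isT.
  have d16 := D 6 1 isT isT h16 isT.
  have d10 := D 0 1 isT isT h10 isT.
  have d32 := D 2 3 isT isT h32 isT.
  have d34 := D 4 3 isT isT h34 isT.
  have d76 := D 6 7 isT isT h76 isT.
  have d78 := D 8 7 isT isT h78 isT.
  move: h52 d52 h56 d56 h54 d54 h58 d58 h12 d12 h16 d16 h10 d10 h32 d32.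
  move: h34 d34 h76 d76 h78 d78 n50 n18 n14 n72 n36.
  by clear; move=> *; lia.
Qed.

Lemma representable12_avoiding (G : sgraph) :
  representable12 G -> avoiding F_family G.
Proof.
move=> /representable12_model[l [F [R lFR]]] H FH.
case=> S /isomorphic_induced_embedding[f finj fE].
have mH := model_embedding finj fE lFR.
case: FH f finj fE mH => [-> f _ _ /X_graph_no_model //|[n n4 ->] f _ _].
by apply: cycle_graph_no_model; lia.
Qed.

(** * Words from intervals *)

Lemma mem2_uniq (T : eqType) (s : seq T) (x y : T) :
  uniq s -> y \in s -> mem2 s x y = (index x s <= index y s).
Proof.
move=> us ys; rewrite /mem2 leqNgt -(in_take _ ys).
move: us ys; rewrite -{1 2}(cat_take_drop (index x s) s) cat_uniq mem_cat.
case/and3P=> _ /hasPn dj _; case: (boolP (y \in drop _ s)) => [/dj/negbTE /= -> //|].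
by rewrite orbF => _ ->.
Qed.

(* The letters of the [true] side come first, those of the [false] side last;
   so two letters of the same side never form an edge, and between the two sides
   only the sorted middle part and the labels matter. *)
Lemma interval_bigraph_representable12 (G : sgraph) (col : G -> bool) (a b : G -> nat) :
  (forall x y, sedge x y = [&& col x != col y, a x <= b y & a y <= b x]) ->
  representable12 G.
Proof.
move=> E; pose N := #|G|; pose r (x : G) : nat := enum_rank x.
have rN x : r x < N by apply: ltn_ord.
(* Doubling turns [a x <= b y] into the strict inequality [(a x).*2 < (b y).*2.+1] and excludes ties
   between the two sides. The key [k1] orders the labels, with [r] breaking ties, and [k2] orders
   the middle part of the word. *)
pose k1 x := if col x then (b x).*2.+1 else (a x).*2.
pose k2 x := if col x then (a x).*2 else (b x).*2.+1.
pose l x := (k1 x * N + r x).+1.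
have lltW x y : k1 x < k1 y -> l x < l y.
  by move=> h; rewrite /l; have := rN x; have := rN y; nia.
have linj : injective l.
  move=> x y [e]; apply: enum_rank_inj; apply: val_inj.
  have := congr1 (fun n => n %% N) e.
  by rewrite !modnMDl !modn_small.
pose M := sort (relpre k2 leq) (enum G).
pose Ws := [seq x <- enum G | col x]; pose Us := [seq x <- enum G | ~~ col x].
have inM x : x \in M by rewrite mem_sort mem_enum.
have inW x : (x \in Ws) = col x by rewrite mem_filter mem_enum andbT.
have inU x : (x \in Us) = ~~ col x by rewrite mem_filter mem_enum andbT.
have uM : uniq M by rewrite sort_uniq enum_uniq.
have k2tot : total (relpre k2 leq) by move=> x y; apply: leq_total.
have k2tr : transitive (relpre k2 leq) by move=> y x z; apply: leq_trans.
have k2refl : reflexive (relpre k2 leq) by move=> x; apply: leqnn.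
have M2 x y : k2 x != k2 y -> mem2 M x y = (k2 x < k2 y).
  have Mle u v : index u M <= index v M -> k2 u <= k2 v.
    exact: (sorted_leq_index k2tr k2refl (sort_sorted k2tot _) u v (inM u) (inM v)).
  move=> ne; rewrite mem2_uniq //.
  by apply/idP/idP => [/Mle|lt]; [|rewrite leqNgt; apply/negP => /ltnW/Mle]; lia.
exists l; first by split.
exists (map l (Ws ++ M ++ Us)); split.
  move=> n; apply/mapP/codomP => [[x _ ->]|[x ->]]; first by exists x.
  by exists x => //; rewrite !mem_cat inM orbT.
have main x y : l x < l y -> (~~ sedge x y <->
    contains12 (subword (map l (Ws ++ M ++ Us)) (pred2 (l x) (l y)))).
  move=> lt; rewrite contains12_pred2 // mem2_map // !mem2_cat.
  have k1le : k1 x <= k1 y by rewrite leqNgt; apply/negP => /lltW; lia.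
  rewrite E mem_cat !inM !inW inU !orTb !andbT.
  case cx: (col x) => /=; case cy: (col y) => /=.
  - by rewrite ?orbT.
  - by rewrite ?orbT; move: k1le; rewrite /k1 cx cy; lia.
  - rewrite !orbF (mem2lf (p := Ws)) ?inW ?cx // (mem2rf (p := Us)) ?inU ?cy //.
    rewrite orbF /= M2; last by rewrite /k2 cx cy; lia.
    by move: k1le; rewrite /k1 /k2 cx cy; lia.
  - by rewrite ?orbT.
move=> x y xy; case: (ltngtP (l x) (l y)) => [lt|lt|/linj e].
- exact: main.
- rewrite sedge_sym.
  have -> : subword (map l (Ws ++ M ++ Us)) (pred2 (l x) (l y)) =
            subword (map l (Ws ++ M ++ Us)) (pred2 (l y) (l x)).
    by apply: eq_filter => n; rewrite /= orbC.
  exact: main.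
- by rewrite e eqxx in xy.
Qed.

(** * Closed walks in the grid *)

Lemma induced_embedding (V : {fset int * int}) (H : sgraph) (f : H -> int * int) :
  injective f -> (forall x, f x \in V) ->
  (forall x y, grid_adj (f x) (f y) = sedge x y) ->
  exists S : {set grid_graph V}, isomorphic (induced S) H.
Proof.
move=> finj fV fE; pose g (x : H) : grid_graph V := [` fV x]%fset.
pose S := [set g x | x : H].
have gS x : g x \in S by apply: imset_f.
pose k (x : H) : induced S := Sub (g x) (gS x).
have kinj : injective k.
  by move=> x y /(congr1 (fun z => val (val z))) /finj.
have ksurj z : exists x, k x == z.
  have /imsetP[x _ e] := valP z; exists x; apply/eqP/val_inj; exact: esym.
pose h z := xchoose (ksurj z).
have hk z : k (h z) = z by apply/eqP/(xchooseP (ksurj z)).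
exists S, h; first by exists k => [z|x]; [exact: hk | apply: kinj; exact: hk].
by move=> x y; rewrite -fE -{2}(hk x) -{2}(hk y).
Qed.

Local Open Scope ring_scope.

Definition dirs : seq (int * int) := [:: (1, 0); (-1, 0); (0, 1); (0, -1)].

Lemma grid_adjD (p a b : int * int) : grid_adj (p + a) (p + b) = grid_adj a b.
Proof.
have e (x y z : int) : x + y - (x + z) = y - z by lia.
by rewrite /grid_adj /= !e.
Qed.

Lemma grid_adjE (p q : int * int) : grid_adj p q = (q - p \in dirs).
Proof.
case: p q => [a b] [c d]; rewrite /grid_adj /dirs !inE /= !xpair_eqE /=.
apply/eqP/idP => [h|]; last by case/or4P=> /andP[/eqP ? /eqP ?]; nia.
have : (-1 <= c - a <= 1) /\ (-1 <= d - b <= 1) by nia.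
nia.
Qed.

Definition color (p : int * int) : bool := odd (absz (p.1 + p.2)).

Lemma grid_adj_color p q : grid_adj p q -> color q = ~~ color p.
Proof.
rewrite grid_adjE /dirs !inE /color; case: p q => [a b] [c d] /=.
by rewrite !xpair_eqE /=; lia.
Qed.

Lemma path_color x p :
  path grid_adj x p -> color (last x p) = color x (+) odd (size p).
Proof.
elim: p x => [|y p IH] x /=; first by rewrite addbF.
by case/andP=> /grid_adj_color e /IH ->; rewrite e; case: (color x) (odd _) => [] [].
Qed.

Lemma cycle_even s : cycle grid_adj s -> ~~ odd (size s).
Proof.
case: s => //= x p /path_color; rewrite last_rcons size_rcons /=.
by case: (color x) (odd _) => [] [].
Qed.

(* The premise says that positions [i < j] are not cyclically consecutive. *)
Definition chordless (s : seq (int * int)) : bool :=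
  all (fun i => all (fun j =>
    (i.+1 < j)%N && ((0 < i)%N || (j.+1 < size s)%N) ==>
    (nth 0 s i != nth 0 s j) && ~~ grid_adj (nth 0 s i) (nth 0 s j))
    (iota 0 (size s))) (iota 0 (size s)).

(** The final point is left out, so that a closed walk has as many points as steps. *)
Fixpoint walk (p : int * int) (ds : seq (int * int)) : seq (int * int) :=
  if ds is d :: ds' then p :: walk (p + d) ds' else [::].

Lemma walkD p q ds : walk (p + q) ds = map (+%R p) (walk q ds).
Proof. by elim: ds q => //= d ds IH q; rewrite -addrA IH. Qed.

Lemma chordless_translate p s : chordless (map (+%R p) s) = chordless s.
Proof.
rewrite /chordless size_map; apply: eq_in_all => i; rewrite mem_iota => /= hi.
apply: eq_in_all => j; rewrite mem_iota => /= hj.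
by rewrite !(nth_map 0) // grid_adjD (inj_eq (addrI p)).
Qed.

(** Encoding closed walks by their steps makes those of a given length, up to translation, a finite
    list that can be checked by computation. *)
Lemma cycle_walk s : cycle grid_adj s ->
  exists ds, [/\ s = walk (head 0 s) ds, all (mem dirs) ds, size ds = size s
                & \sum_(d <- ds) d = 0].
Proof.
case: s => [_|x p]; first by exists [::]; rewrite big_nil.
rewrite /cycle.
have gen y z q : path grid_adj y (rcons q z) ->
  exists ds, [/\ y :: q = walk y ds, all (mem dirs) ds, size ds = (size q).+1
               & \sum_(d <- ds) d = z - y].
  elim: q y => [|t q IH] y /=.
    rewrite andbT grid_adjE => h; exists [:: z - y].
    by rewrite /= h big_seq1.
  case/andP; rewrite grid_adjE => h /IH [ds [e1 e2 e3 e4]].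
  exists ((t - y) :: ds) => /=; rewrite h e2 e3 big_cons e4.
  by split=> //; [rewrite addrC subrK e1 | rewrite addrC subrKA].
by case/gen => ds [e1 e2 e3 e4]; exists ds; split=> //; rewrite e4 subrr.
Qed.

Fixpoint words (T : Type) (A : seq T) n : seq (seq T) :=
  if n is n'.+1 then [seq a :: w | a <- A, w <- words A n'] else [:: [::]].

Lemma mem_words (T : eqType) (A s : seq T) :
  all (mem A) s -> s \in words A (size s).
Proof.
elim: s => //= a s IH /andP[aA /IH sA].
by apply/allpairsP; exists (a, s).
Qed.

Lemma no_chordless_6cycle s : cycle grid_adj s -> size s = 6%N -> ~~ chordless s.
Proof.
move=> /cycle_walk[ds [-> hd hs h0]] s6; rewrite s6 in hs.
have : ds \in words dirs 6 by rewrite -hs mem_words.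
rewrite -(addr0 (head 0 s)) walkD chordless_translate => dw.
have H : all (fun ds => (foldr +%R 0 ds == 0) ==> ~~ chordless (walk 0 ds))
            (words dirs 6) by vm_compute.
by move/allP/(_ _ dw): H; rewrite foldrE h0 eqxx.
Qed.

Definition square_offsets : seq (int * int) :=
  [:: (0, 0); (1, 0); (0, 1); (1, 1)].

Lemma cycle4_square a b c d :
  cycle grid_adj [:: a; b; c; d] -> a != c -> b != d ->
  exists q, [:: a; b; c; d] =i [seq q + o | o <- square_offsets].
Proof.
move=> /cycle_walk[ds [e hd hs h0]] ac bd.
have dw : ds \in words dirs 4 by rewrite -[4%N]/(size [:: a; b; c; d]) -hs mem_words.
pose sq (o : int * int) := [seq o + o' | o' <- square_offsets].
pose good o (s : seq (int * int)) := all (mem s) (sq o) && all (mem (sq o)) s.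
(* The walk starts at any of the four corners of the square, so the lower left corner has one of
   four offsets from the starting point. *)
have H : all (fun ds => let s := walk 0 ds in
   [&& foldr +%R 0 ds == 0, nth 0 s 0 != nth 0 s 2 & nth 0 s 1 != nth 0 s 3] ==>
   has (fun o => good o s) [:: (0, 0); (-1, 0); (0, -1); (-1, -1)])
            (words dirs 4) by vm_compute.
have e' : [:: a; b; c; d] = map (+%R a) (walk 0 ds).
  by rewrite -walkD addr0 [LHS]e.
have sz : size (walk 0 ds) = 4%N by rewrite -(size_map (+%R a)) -e'.
have nt i : (i < 4)%N -> a + nth 0 (walk 0 ds) i = nth 0 [:: a; b; c; d] i.
  by move=> i4; rewrite e' (nth_map 0) ?sz.
have n1 : nth 0 (walk 0 ds) 0 != nth 0 (walk 0 ds) 2.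
  by rewrite -(inj_eq (addrI a)) !nt.
have n2 : nth 0 (walk 0 ds) 1 != nth 0 (walk 0 ds) 3.
  by rewrite -(inj_eq (addrI a)) !nt.
move/allP/(_ _ dw): H; cbv zeta; rewrite foldrE h0 eqxx n1 n2.
case/hasP=> o _ /andP[/allP h1 /allP h2]; exists (a + o) => z.
rewrite e'; apply/mapP/mapP => [[t /h2 /mapP[o' o's ->] ->]|[o' o's ->]].
- by exists o'; rewrite // addrA.
- exists (o + o'); last by rewrite addrA.
  by apply: h1; apply: map_f.
Qed.


Lemma cycle_nth (T : eqType) (e : rel T) (x0 : T) (s : seq T) (i : nat) :
  cycle e s -> (i < size s)%N -> e (nth x0 s i) (nth x0 s (i.+1 %% size s)).
Proof.
case: s => // x p; rewrite /cycle => /(pathP x0) H isz; have := H i.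
rewrite size_rcons => /(_ isz).
rewrite -rcons_cons nth_rcons isz nth_rcons -[size (x :: p)]/(size p).+1.
case: (ltngtP i (size p)) => h; first by rewrite modn_small.
- by move: isz => /=; lia.
- by rewrite h modnn.
Qed.

Lemma chordless_cycle_embedding (V : {fset int * int}) (s : seq (int * int)) :
  (3 < size s)%N -> cycle grid_adj s -> chordless s -> {subset s <= V} ->
  exists S : {set grid_graph V}, isomorphic (induced S) (cycle_graph (size s)).
Proof.
move=> s3 cs /allP chs sV.
have nochord i j : (i.+1 < j)%N -> (j < size s)%N -> (0 < i)%N || (j.+1 < size s)%N ->
    nth 0 s i != nth 0 s j /\ grid_adj (nth 0 s i) (nth 0 s j) = false.
  move=> ij js h; have is_ : (i < size s)%N by lia.
  have ii : i \in iota 0 (size s) by rewrite mem_iota.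
  have /allP/(_ j) := chs i ii.
  by rewrite mem_iota ij h /= add0n => /(_ js)/andP[-> /negbTE ->].
pose f (i : cycle_graph (size s)) := nth 0 s (val i).
have adjE (i j : 'I_(size s)) : (i < j)%N -> grid_adj (nth 0 s i) (nth 0 s j) =
    (j == i.+1 :> nat) || (i == 0%N :> nat) && (j.+1 == size s).
  move=> ij; have js := ltn_ord j.
  case: (ltngtP j i.+1) => [|ij1|ji] /=; first by lia.
  - case: (boolP ((0 < i)%N || (j.+1 < size s)%N)) => h.
      by have [_ ->] := nochord i j ij1 js h; lia.
    have -> : (i == 0%N :> nat) && (j.+1 == size s) by lia.
    rewrite grid_adj_sym; have := cycle_nth 0 cs js.
    have -> : j.+1 = size s by lia.
    by rewrite modnn; have -> : nat_of_ord i = 0%N by lia.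
  - have := cycle_nth 0 cs (ltn_ord i).
    by rewrite modn_small -ji.
(* [chordless] separates only positions that are not cyclically consecutive; consecutive ones differ
   because they are adjacent. *)
have neq (i j : 'I_(size s)) : (i < j)%N -> nth 0 s i != nth 0 s j.
  move=> ij; have js := ltn_ord j; apply/eqP => e.
  have := adjE i j ij; rewrite -e grid_adj_irrefl => /esym/norP[h1 h2].
  have [||] := nochord i j _ js; [lia | lia | by rewrite e eqxx].
have ordSE (i : 'I_(size s)) : val (ordS i) = if i.+1 == size s then 0%N else i.+1.
  rewrite /=; case: eqP => [->|h]; first by rewrite modnn.
  by rewrite modn_small //; have := ltn_ord i; lia.
have ltE (i j : 'I_(size s)) : (i < j)%N -> grid_adj (f i) (f j) = cycle_edge i j.
  move=> ij; rewrite adjE // /cycle_edge -!val_eqE !ordSE /=.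
  have js := ltn_ord j; have is_ := ltn_ord i.
  by do 2 case: ifP; lia.
apply: (@induced_embedding V _ f).
- move=> i j; case: (ltngtP i j) => [||/val_inj //] ij e.
    by have := neq _ _ ij; rewrite -[nth _ _ i]/(f i) e eqxx.
  by have := neq _ _ ij; rewrite -[nth _ _ i]/(f i) e eqxx.
- by move=> i; apply: sV; apply: mem_nth; apply: ltn_ord.
- move=> i j; case: (ltngtP i j) => [ij|ij|/val_inj ->]; first exact: ltE.
    by rewrite grid_adj_sym sedge_sym; apply: ltE.
  by rewrite grid_adj_irrefl sedge_irrefl.
Qed.

Lemma chordlessPn (s : seq (int * int)) : ~~ chordless s -> exists i j : nat,
  [/\ (i.+1 < j)%N, (j < size s)%N, (0 < i)%N || (j.+1 < size s)%N
    & (nth 0 s i == nth 0 s j) || grid_adj (nth 0 s i) (nth 0 s j)].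
Proof.
case/allPn=> i _ /allPn[j]; rewrite mem_iota => /= js.
rewrite negb_imply negb_and !negbK => /andP[/andP[ij wrap] xy].
by exists i, j.
Qed.

(** * Cocycles with values in [bool] *)

Section Cocycle.
Variables (V : {fset int * int}) (phi : int * int -> int * int -> bool).

Fixpoint path_weight x p : bool :=
  if p is y :: p' then phi x y (+) path_weight y p' else false.

Definition cycle_weight s : bool :=
  if s is x :: p then path_weight x (rcons p x) else false.

Lemma path_weight_cat x p q :
  path_weight x (p ++ q) = path_weight x p (+) path_weight (last x p) q.
Proof. by elim: p x => //= y p IH x; rewrite IH addbA. Qed.

Lemma cycle_weight_catC s t : cycle_weight (s ++ t) = cycle_weight (t ++ s).
Proof.
case: s t => [|x s] [|y t] //=; rewrite ?cats0 //.
rewrite !rcons_cat !path_weight_cat /= -!cats1 !path_weight_cat /=.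
by rewrite !addbF addbA [RHS]addbA addbC.
Qed.

Hypothesis V_avoid : avoiding F_family (grid_graph V).
Hypothesis phi_sym : forall x y, phi x y = phi y x.
Hypothesis phi_square : forall a b c d : int * int,
  {subset [:: a; b; c; d] <= V} -> cycle grid_adj [:: a; b; c; d] ->
  a != c -> b != d -> cycle_weight [:: a; b; c; d] = false.

(* An odd closed walk that is not an induced cycle splits along a chord or a
   repeated vertex into two shorter closed walks, one of which is odd. *)
Lemma cycle_weight0 (s : seq (int * int)) :
  {subset s <= V} -> cycle grid_adj s -> cycle_weight s = false.
Proof.
have [n] := ubnP (size s); elim: n s => // n IH s sn sV cs.
have [ch|] := boolP (chordless s); last first.
  case/chordlessPn=> i [j [ij js wrap xy]]; have i_s : (i < size s)%N by lia.
  have [t1 [p1 [p2 [es n1 n2]]]] : exists t1 p1 p2 : seq (int * int),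
    [/\ s = t1 ++ nth 0 s i :: p1 ++ nth 0 s j :: p2, (0 < size p1)%N
      & (0 < size p2 + size t1)%N].
    exists (take i s), (take (j - i.+1) (drop i.+1 s)), (drop j.+1 s); split.
    - rewrite -{1}(cat_take_drop i s) (drop_nth 0) //; congr (_ ++ _ :: _).
      rewrite -{1}(cat_take_drop (j - i.+1) (drop i.+1 s)) drop_drop.
      by rewrite subnK ?(ltnW ij) // (drop_nth 0 js).
    - by rewrite size_takel ?size_drop ?leq_sub2r ?(ltnW js) ?subn_gt0.
    - rewrite size_drop size_takel; last exact: ltnW.
      by rewrite addn_gt0 subn_gt0 orbC.
  (* The positions are forgotten, and a rotation brings the walk to the form [x :: p1 ++ y :: q].
     Both [p1] and [q] are nonempty, which makes the two parts shorter than the whole. *)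
  move: (nth 0 s i) (nth 0 s j) es xy => x y es xy {i_s js ij wrap}.
  have {}es : rot (size t1) s = x :: p1 ++ y :: (p2 ++ t1).
    by rewrite {1}es rot_size_cat /= -catA.
  rewrite -(cat_take_drop (size t1) s) cycle_weight_catC -/(rot _ _) es.
  have {}cs : cycle grid_adj (rot (size t1) s) by rewrite rot_cycle.
  have {}sn : (size (rot (size t1) s) < n.+1)%N by rewrite size_rot.
  rewrite es in cs; rewrite es in sn.
  have {}sV : {subset x :: p1 ++ y :: (p2 ++ t1) <= V}.
    by move=> z; rewrite -es mem_rot; apply: sV.
  move: n2 cs sV sn; rewrite -size_cat; move: (p2 ++ t1) => q n2 cs sV sn {es}.
  have xV : x \in V by apply: sV; rewrite mem_head.
  have yV : y \in V by apply: sV; rewrite inE mem_cat mem_head !orbT.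
  have p1V : {subset p1 <= V} by move=> z h; apply: sV; rewrite inE mem_cat h orbT.
  have qV : {subset q <= V}.
    by move=> z h; apply: sV; rewrite inE mem_cat inE h !orbT.
  move: sn; rewrite /= size_cat /= => sn.
  move: cs; rewrite /= rcons_cat cat_path /= => /and3P[pp1 ey pq].
  rewrite path_weight_cat /=.
  case/orP: xy => [/eqP exy|exy].
  - move: ey pq yV; rewrite -exy => ey pq _ {y exy sV}.
    have h1 : cycle_weight (x :: p1) = false.
      apply: IH; first by rewrite /=; lia.
        by move=> z; rewrite inE => /predU1P[->|/p1V].
      by rewrite /= rcons_path pp1.
    have h2 : cycle_weight (x :: q) = false.
      apply: IH; first by rewrite /=; lia.
        by move=> z; rewrite inE => /predU1P[->|/qV].
      by [].
    move: h1 h2; rewrite /= -cats1 path_weight_cat /= addbF => h1 h2.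
    by rewrite addbA h1 h2.
  (* The two parts traverse the chord in opposite directions, so its contributions cancel. *)
  - have h1 : cycle_weight (x :: rcons p1 y) = false.
      apply: IH; first by rewrite /= size_rcons; lia.
        move=> z; rewrite inE mem_rcons inE.
        by case/predU1P=> [->|/predU1P[->|/p1V]].
      by rewrite /= !rcons_path last_rcons pp1 ey grid_adj_sym.
    have h2 : cycle_weight (y :: rcons q x) = false.
      apply: IH; first by rewrite /= size_rcons; lia.
        move=> z; rewrite inE mem_rcons inE.
        by case/predU1P=> [->|/predU1P[->|/qV]].
      by rewrite /= rcons_path pq last_rcons.
    move: h1 h2; rewrite /= -[rcons (rcons p1 y) x]cats1 -[rcons (rcons q x) y]cats1.
    rewrite !path_weight_cat !last_rcons /= !addbF -cats1 path_weight_cat /= addbF.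
    rewrite [phi y x]phi_sym -[rcons q x]cats1 path_weight_cat /= addbF.
    by case: (phi x y) (phi _ y) (phi _ x) (path_weight x p1) (path_weight y q)
      => [] [] [] [] [].
(* A chordless closed walk has even length. Length at least 8 is forbidden and 6 is impossible,
   which leaves the empty walk, a step back and forth, and squares. *)
have ev := cycle_even cs.
have [s8|] := leqP 8 (size s).
  have [S iso] := chordless_cycle_embedding (ltn_trans (isT : 3 < 7)%N s8) cs ch sV.
  case: (@V_avoid (cycle_graph (size s))); last by exists S.
  right; exists (size s)./2; first by lia.
  by congr cycle_graph; lia.
have [s6|s6 s8] := eqVneq (size s) 6.
  by have := no_chordless_6cycle cs s6; rewrite ch.
case: s {sn} sV cs ch ev s6 s8 => [|a [|b [|c [|d [|e [|f [|g s]]]]]]] //=.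
- by move=> *; rewrite phi_sym addbF addbb.
- move=> sV cs ch _ _ _; apply: phi_square => //.
  + by move/allP/(_ 0%N)/(_ isT)/allP/(_ 2%N)/(_ isT): ch => /andP[].
  + by move/allP/(_ 1%N)/(_ isT)/allP/(_ 3%N)/(_ isT): ch => /andP[].
- by case: s.
Qed.

Hypothesis V_conn : connected (grid_graph V).

(** [phi] defines a double cover [cov] of the graph. As closed walks have weight zero, the two
    points over a vertex are never connected, and [g] records which of them is reached from a base
    point. *)
Lemma cocycle_coboundary :
  exists g : int * int -> bool, forall x y, x \in V -> y \in V ->
    grid_adj x y -> phi x y = g x (+) g y.
Proof.
have [V0|[x0 x0V]] := fset_0Vmem V.
  by exists (fun _ => false) => x y; rewrite V0 inE.
pose cov : rel (V * bool) := fun a b =>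
  grid_adj (val a.1) (val b.1) && (b.2 == a.2 (+) phi (val a.1) (val b.1)).
have cov_path a p : path cov a p ->
  path grid_adj (val a.1) [seq val b.1 | b <- p] /\
  (last a p).2 = a.2 (+) path_weight (val a.1) [seq val b.1 | b <- p].
  elim: p a => [|b p IH] a /=; first by rewrite addbF.
  case/andP=> /andP[-> /eqP e] /IH [-> ->]; split=> //.
  by rewrite e addbA.
have cov_fun x s t : connect cov (x, s) (x, t) -> s = t.
  case/connectP=> p pp e; have [pg /=] := cov_path _ _ pp.
  rewrite -e /= => ->; case/lastP: p e pp pg => [|p b] e pp pg.
    by rewrite addbF.
  move: e; rewrite last_rcons => e; rewrite map_rcons -e /=.
  rewrite -[path_weight _ _]/(cycle_weight (val x :: [seq val b.1 | b <- p])).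
  rewrite cycle_weight0 ?addbF //.
    by move=> z; rewrite inE => /predU1P[->|/mapP[c _ ->]]; apply: fsvalP.
  by move: pg; rewrite map_rcons -e.
have cov_sym : connect_sym cov.
  apply: sym_connect_sym => a b; rewrite /cov grid_adj_sym; congr (_ && _).
  by rewrite phi_sym; case: a.2 b.2 (phi _ _) => [] [] [].
pose z : V * bool := ([` x0V]%fset, false).
pose g (x : int * int) := if insub x is Some v then connect cov z (v, true) else false.
have reach_path p (a : V * bool) : path (@grid_edge V) a.1 p ->
    exists s, connect cov a (last a.1 p, s).
  elim: p a => [|y p IH] a /=.
    by exists a.2; case: a => ? ?; apply: connect0.
  case/andP=> ay pp; pose b : V * bool := (y, a.2 (+) phi (val a.1) (val y)).
  have [s h] := IH b pp; exists s; apply: connect_trans h.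
  by apply: connect1; rewrite /cov /= eqxx andbT.
have reach (v : V) : exists s, connect cov z (v, s).
  have /connectP[p pp ->] := V_conn [` x0V]%fset v.
  exact: (reach_path p z pp).
have gE (v : V) s : connect cov z (v, s) -> g (val v) = s.
  move=> h; rewrite /g valK; case: s h => [-> //|h].
  apply/negP=> h'; have : connect cov (v, false) (v, true).
    by apply: connect_trans h'; rewrite cov_sym.
  by move/cov_fun.
exists g => x y xV yV xy.
have [s h] := reach [` xV]%fset.
have h' : connect cov z ([` yV]%fset, s (+) phi x y).
  by apply: connect_trans h _; apply: connect1; rewrite /cov /= xy eqxx.
have := gE _ _ h; have := gE _ _ h' => /= -> ->.
by rewrite addbA addbb.
Qed.

End Cocycle.

(** * Local structure of the cells *)


Definition ring8 : seq (int * int) :=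
  [:: (-1, -1); (0, -1); (1, -1); (1, 0); (1, 1); (0, 1); (-1, 1); (-1, 0)].

(** The eight points around [c] induce an 8-cycle, whether or not [c] itself belongs to [V]. *)
Lemma ring8_free (V : {fset int * int}) c :
  avoiding F_family (grid_graph V) -> ~~ all (fun o => c + o \in V) ring8.
Proof.
move=> avo; apply/negP => /allP inV.
case: (@chordless_cycle_embedding V [seq c + o | o <- ring8]) => //.
- by rewrite /= !grid_adjD; vm_compute.
- by rewrite chordless_translate; vm_compute.
- by move=> _ /mapP[o oR ->]; apply: inV.
- by move=> S iso; apply: (avo (cycle_graph 8)); [right; exists 4%N | exists S].
Qed.

(* The vertices [a, ..., i] of [X] drawn around [f = (0, 0)], up to the
   symmetries of the grid. *)
Definition X_patterns : seq (seq (int * int)) :=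
  [seq [seq t o | o <- [:: (-2, -1); (-1, -1); (-1, 0); (-1, 1); (0, 1); (0, 0);
                           (0, -1); (1, -1); (1, 0)]]
     | t : int * int -> int * int <-
       [:: fun o => (o.1, o.2); fun o => (- o.1, o.2);
           fun o => (o.1, - o.2); fun o => (- o.1, - o.2);
           fun o => (o.2, o.1); fun o => (- o.2, o.1);
           fun o => (o.2, - o.1); fun o => (- o.2, - o.1)]].

Lemma X_patterns_free (V : {fset int * int}) c pat :
  avoiding F_family (grid_graph V) -> pat \in X_patterns ->
  ~~ all (fun o => c + o \in V) pat.
Proof.
move=> avo patX; apply/negP => /allP inV.
have /allP/(_ _ patX)/and3P[/eqP sz un /allP E] : all (fun pat =>
   [&& size pat == 9, uniq pat & all (fun i => all (fun j =>
       grid_adj (nth 0 pat i) (nth 0 pat j) ==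
       ((i, j) \in X_edges) || ((j, i) \in X_edges)) (iota 0 9)) (iota 0 9)])
  X_patterns by vm_compute.
pose f (i : X_graph) := c + nth 0 pat (val i).
have lt9 (i : X_graph) : (val i < 9)%N by apply: ltn_ord.
case: (@induced_embedding V X_graph f).
- move=> i j /addrI/eqP; rewrite nth_uniq ?sz // => /eqP; exact: val_inj.
- by move=> i; apply: inV; rewrite mem_nth // sz.
- move=> i j; rewrite grid_adjD.
  have /E/allP/(_ (val j)) : val i \in iota 0 9 by rewrite mem_iota lt9.
  by rewrite mem_iota lt9 => /(_ isT)/eqP ->.
- by move=> S iso; apply: (avo X_graph); [left | exists S].
Qed.

Definition diags : seq (int * int) := [:: (1, 1); (1, -1); (-1, 1); (-1, -1)].

(** A cell is named by its lower left corner. Taking a predicate [W] instead of a finite set makes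
    it easy to move any cell to the origin. *)
Definition cell (W : int * int -> bool) (p : int * int) : bool :=
  all (fun o => W (p + o)) square_offsets.

Definition in_cell (v p : int * int) : bool := v - p \in square_offsets.

(* Diagonal cells joined by a third cell are not linked, so that the three cells
   of a turn form a path and not a triangle. *)
Definition link (W : int * int -> bool) (p q : int * int) : bool :=
  [&& cell W p, cell W q
    & (q - p \in dirs) ||
      [&& q - p \in diags, ~~ cell W (p.1, q.2) & ~~ cell W (q.1, p.2)]].

Lemma cell_translate W c p : cell W (c + p) = cell (fun o => W (c + o)) p.
Proof. by rewrite /cell /=; rewrite !addrA. Qed.

Lemma link_translate W c p q :
  link W (c + p) (c + q) = link (fun o => W (c + o)) p q.
Proof.
rewrite /link !cell_translate -!(cell_translate W c).
have -> : c + q - (c + p) = q - p by rewrite opprD addrACA subrr add0r.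
by [].
Qed.

Definition pattern_free (W : int * int -> bool) : Prop :=
  forall c pat, pat \in ring8 :: X_patterns -> ~~ all (fun o => W (c + o)) pat.

Lemma avoiding_pattern_free (V : {fset int * int}) :
  avoiding F_family (grid_graph V) -> pattern_free (fun o => o \in V).
Proof.
move=> avo c pat; rewrite inE => /predU1P[->|]; first exact: ring8_free.
exact: X_patterns_free.
Qed.

Lemma pattern_free_translate W c :
  pattern_free W -> pattern_free (fun o => W (c + o)).
Proof.
move=> free d pat /(free (c + d)); apply: contra; apply: sub_all => o.
by rewrite addrA.
Qed.

Lemma cell_in W p v : cell W p -> in_cell v p -> W v.
Proof. by move=> /allP h /h; rewrite addrC subrK. Qed.

(** The four cells around [v] cover the 8-cycle around it. *)
Lemma four_cells W v : pattern_free W ->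
  ~~ [&& cell W v, cell W (v + (-1, 0)), cell W (v + (0, -1))
       & cell W (v + (-1, -1))].
Proof.
move=> free; apply/negP => /and4P[c1 c2 c3 c4].
case/negP: (free v ring8 isT).
apply/allP => o oR; have : has (fun c => in_cell o c) [:: 0; (-1, 0); (0, -1); (-1, -1)].
  by move: o oR; apply/allP; vm_compute.
have inc c : cell W (v + c) -> in_cell o c -> W (v + o).
  move=> h h'; apply: (cell_in h); rewrite /in_cell.
  by have -> : v + o - (v + c) = o - c by rewrite opprD addrACA subrr add0r.
by rewrite /= orbF => /or4P[]; apply: inc; rewrite ?addr0.
Qed.

(** The cells at [0], [dx] and [dy] form an L. A further cell on the outer side of its corner cell
    supplies the pendant vertex of a copy of [X]. *)
Lemma outer_corner W dx dy : pattern_free W ->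
  dx \in [:: (1, 0); (-1, 0)] -> dy \in [:: (0, 1); (0, -1)] ->
  cell W 0 -> cell W dx -> cell W dy ->
  [&& ~~ cell W (- dx), ~~ cell W (- dy) & ~~ cell W (- dx - dy)].
Proof.
move=> free dxP dyP c0 cx cy.
pose pts := flatten [seq [seq c + o | o <- square_offsets] | c <- [:: 0; dx; dy]].
have inpts v : v \in pts -> W v.
  case/flatten_mapP=> c cP /mapP[o oP ->].
  by move: cP; rewrite !inE => /or3P[]/eqP ->;
    [move/allP: c0 | move/allP: cx | move/allP: cy]; apply.
have step d : d \in [:: - dx; - dy; - dx - dy] -> ~~ cell W d.
  move=> dP; apply/negP => /allP cd.
  (* The shift [c] is the place of the vertex [f] of [X], a corner of the cell at the origin. *)
  have : has (fun pat => has (fun c => all (fun o => (c + o \in pts) ||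
      (c + o \in [seq d + o | o <- square_offsets])) pat)
      [:: (0, 0); (1, 0); (0, 1); (1, 1)]) X_patterns.
    move: d dx dy dxP dyP @pts dP {c0 cx cy inpts cd} => d dx dy.
    rewrite !inE => /orP[]/eqP-> /orP[]/eqP-> pts /or3P[]/eqP->; by vm_compute.
  case/hasP=> pat patP /hasP[c _ /allP h].
  case/negP: (free c pat (mem_behead (s := ring8 :: _) patP)).
  apply/allP => o /h /orP[/inpts //|/mapP[o' /cd ? ->]] //.
by rewrite !step // !inE eqxx ?orbT.
Qed.

(** All corners of the middle cell already belong to the three given cells. *)
Lemma between_diagonals W dx dy :
  dx \in [:: (1, 0); (-1, 0)] -> dy \in [:: (0, 1); (0, -1)] ->
  cell W 0 ->
  (cell W (dx + dy) -> cell W (dx - dy) -> cell W dx) /\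
  (cell W (dx + dy) -> cell W (dy - dx) -> cell W dy).
Proof.
move=> dxP dyP /allP c0.
have gen d d1 d2 : all (fun o => has (fun c => d + o - c \in square_offsets)
    [:: 0; d1; d2]) square_offsets -> cell W d1 -> cell W d2 -> cell W d.
  move=> /allP h /allP c1 /allP c2; apply/allP => o /h.
  by case/or4P=> // hc; [have := c0 _ hc | have := c1 _ hc | have := c2 _ hc];
    rewrite addrC subrK.
move: dxP dyP; rewrite !inE.
by case/orP=> /eqP-> /orP[]/eqP->; split; apply: gen; vm_compute.
Qed.

Definition nbr_offsets : seq (int * int) := dirs ++ diags.

(** With the geometry condensed into [outer_corner] and [between_diagonals], the bound is a
    propositional statement about the eight surrounding cells, decided by cases. *)
Lemma link_count W : pattern_free W -> cell W 0 ->
  (size [seq q <- nbr_offsets | link W 0%R q] <= 2)%N.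
Proof.
move=> free c0.
have oc dx dy := @outer_corner W dx dy free.
have bd dx dy := @between_diagonals W dx dy.
have {oc} [o1 o2 o3 o4] := And4 (oc (1, 0) (0, 1) isT isT c0)
  (oc (1, 0) (0, -1) isT isT c0) (oc (-1, 0) (0, 1) isT isT c0)
  (oc (-1, 0) (0, -1) isT isT c0).
have [b1 b2] := bd (1, 0) (0, 1) isT isT c0.
have [b3 b4] := bd (-1, 0) (0, -1) isT isT c0.
have le d : d \in dirs -> link W 0 d = cell W d.
  by move=> dd; rewrite /link c0 subr0 dd andbT.
have ld d : d \in diags ->
    link W 0 d = [&& cell W d, ~~ cell W (0, d.2) & ~~ cell W (d.1, 0)].
  by move=> dd; rewrite /link c0 subr0 dd; case: d dd => a b; rewrite !inE;
    case/or4P=> /eqP[-> ->].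
rewrite size_filter /nbr_offsets /=.
rewrite (le (1, 0) isT) (le (-1, 0) isT) (le (0, 1) isT) (le (0, -1) isT).
rewrite (ld (1, 1) isT) (ld (1, -1) isT) (ld (-1, 1) isT) (ld (-1, -1) isT) /=.
move: o1 o2 o3 o4 b1 b2 b3 b4.
rewrite -[- (1, 0)]/(-1, 0) -[- (0, 1)]/(0, -1) -[- (-1, 0)]/(1, 0) -[- (0, -1)]/(0, 1).
rewrite -[(1, 0) + (0, 1)]/(1, 1) -[(-1, 0) + (0, -1)]/(-1, -1).
rewrite -[(1, 0) + (0, -1)]/(1, -1) -[(-1, 0) + (0, 1)]/(-1, 1).
rewrite -[(0, 1) + (-1, 0)]/(-1, 1) -[(0, -1) + (1, 0)]/(1, -1).
have imp2 (a b c : bool) : (a -> b -> c) -> [==> a, b => c].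
  by case: a b => [] [] // h; apply: h.
move=> /imp2 + /imp2 + /imp2 + /imp2 + /imp2 + /imp2 + /imp2 + /imp2.
by case: (cell W (1, 0)); case: (cell W (-1, 0)); case: (cell W (0, 1));
   case: (cell W (0, -1)); case: (cell W (1, 1)); case: (cell W (1, -1));
   case: (cell W (-1, 1)); case: (cell W (-1, -1)).
Qed.

Lemma link_sym W : symmetric (link W).
Proof.
move=> p q; rewrite /link andbCA; congr [&& _, _ & _].
have oppE (s : seq (int * int)) : all (fun o => - o \in s) s ->
    (q - p \in s) = (p - q \in s).
  by move=> /allP h; apply/idP/idP => /h; rewrite opprB.
by rewrite !oppE //; congr (_ || (_ && _)); rewrite andbC.
Qed.

Lemma link_offset W p q : link W p q -> q - p \in nbr_offsets.
Proof.
case/and3P=> _ _; rewrite mem_cat => /orP[->|/and3P[-> _ _]] //.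
by rewrite orbT.
Qed.

Lemma link_degree W p (s : seq (int * int)) : pattern_free W ->
  uniq s -> all (link W p) s -> (size s <= 2)%N.
Proof.
move=> free us /allP ls.
have [|] := boolP (cell W p); last first.
  by case: s us ls => // q s _ /(_ _ (mem_head _ _))/and3P[->].
move=> cp; have {}free := pattern_free_translate p free.
have c0 : cell (fun o => W (p + o)) 0 by rewrite -cell_translate addr0.
apply: leq_trans (link_count free c0); rewrite -(size_map (fun q => q - p)).
apply: uniq_leq_size; first by rewrite map_inj_uniq //; apply: addIr.
move=> _ /mapP[q /ls lq ->]; rewrite mem_filter (link_offset lq) andbT.
by rewrite -link_translate addr0 addrC subrK.
Qed.

(** Three pairwise neighboring cells lie in a two by two block: two of them are diagonal, and the
    third lies between these and thereby prevents their link. *)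
Lemma link_triangle W p q r : link W p q -> link W q r -> ~~ link W p r.
Proof.
move=> lpq lqr; apply/negP => lpr.
have cp : cell W p by case/and3P: lpq.
have cq : cell W q by case/and3P: lpq.
have cr : cell W r by case/and3P: lqr.
have corner a b c : link W a b -> b - a \in diags ->
   cell W c -> ~~ ((c - a == (0, (b - a).2)) || (c - a == ((b - a).1, 0))).
  move=> /and3P[_ _ /orP[ab|/and3P[_ n1 n2]]] abd cc.
    by move: abd; apply: contraTN => _; move: (b - a) ab; apply/allP; vm_compute.
  apply/norP; split; apply: contraL cc => /eqP e.
    have -> // : c = (a.1, b.2).
    by case: a b c e {n1 n2 abd} => [? ?] [? ?] [? ?] /= [? ?]; congr pair; lia.
  have -> // : c = (b.1, a.2).
  by case: a b c e {n1 n2 abd} => [? ?] [? ?] [? ?] /= [? ?]; congr pair; lia.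
have := corner _ _ q lpr; have := corner _ _ r lpq; have := corner _ _ p lqr.
have := link_offset lpr.
have -> : p - q = - (q - p) by rewrite opprB.
have -> : r - p = (r - q) + (q - p) by rewrite addrA subrK.
move: (link_offset lqr) (link_offset lpq).
move: (r - q) (q - p) => d e dn en den h1 h2 h3.
have : all (fun d => all (fun e => (d + e \in nbr_offsets) ==>
   [|| (d \in diags) && ((- e == (0, d.2)) || (- e == (d.1, 0))),
     (e \in diags) && ((d + e == (0, e.2)) || (d + e == (e.1, 0)))
   | (d + e \in diags) && ((e == (0, (d + e).2)) || (e == ((d + e).1, 0)))])
   nbr_offsets) nbr_offsets by vm_compute.
move=> /allP/(_ _ dn)/allP/(_ _ en); rewrite den => /or3P[]/andP[hd].
- by apply/negP; apply: h1.
- by apply/negP; apply: h2.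
- by apply/negP; apply: h3.
Qed.

Lemma in_cellE v p :
  in_cell v p = (p.1 <= v.1 <= p.1 + 1) && (p.2 <= v.2 <= p.2 + 1).
Proof.
case: v p => [a b] [c d]; rewrite /in_cell /square_offsets !inE /= !xpair_eqE /=.
lia.
Qed.

Lemma dirsE p q : (q - p \in dirs) =
  (p.1 == q.1) && ((q.2 == p.2 + 1) || (p.2 == q.2 + 1)) ||
  (p.2 == q.2) && ((q.1 == p.1 + 1) || (p.1 == q.1 + 1)).
Proof. by case: p q => [a b] [c d]; rewrite /dirs !inE /= !xpair_eqE /=; lia. Qed.

Lemma diagsE p q : (q - p \in diags) =
  ((q.1 == p.1 + 1) || (p.1 == q.1 + 1)) && ((q.2 == p.2 + 1) || (p.2 == q.2 + 1)).
Proof. by case: p q => [a b] [c d]; rewrite /diags !inE /= !xpair_eqE /=; lia. Qed.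

(** Unlinked cells at a common vertex are diagonal, and one of the two cells between them is
    present. *)
Lemma linked_at_vertex W v p q : cell W p -> cell W q ->
  in_cell v p -> in_cell v q -> p != q ->
  link W p q \/ exists r, [/\ in_cell v r, link W p r & link W r q].
Proof.
move=> cp cq vp vq pq; have [l|nl] := boolP (link W p q); [by left | right].
have side r : r.1 = p.1 /\ r.2 = q.2 \/ r.1 = q.1 /\ r.2 = p.2 -> cell W r ->
  q - p \in diags -> [/\ in_cell v r, link W p r & link W r q].
  move=> rE cr; move: vp vq; rewrite /link cp cq cr !in_cellE !dirsE !diagsE /=.
  by case: p q v r {pq nl cp cq cr} rE => [? ?] [? ?] [? ?] [? ?] /= rE *; split; lia.
have nd : q - p \notin dirs by apply: contra nl => h; rewrite /link cp cq h.
have dg : q - p \in diags.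
  move: nd pq vp vq; rewrite dirsE diagsE !in_cellE.
  by case: p q v {side cp cq nl} => [? ?] [? ?] [? ?] /=; rewrite xpair_eqE; lia.
have [cr|n1] := boolP (cell W (p.1, q.2)).
  by exists (p.1, q.2); apply: side => //; left.
have [cr|n2] := boolP (cell W (q.1, p.2)).
  by exists (q.1, p.2); apply: side => //; right.
by case/negP: nl; rewrite /link cp cq dg n1 n2 orbT.
Qed.

Lemma link_common_vertex W p q : link W p q -> exists2 v, in_cell v p & in_cell v q.
Proof.
move=> /link_offset pq.
have : has (fun o => o - (q - p) \in square_offsets) square_offsets.
  by move: (q - p) pq; apply/allP; vm_compute.
case/hasP=> o oS oS'; exists (p + o); rewrite /in_cell.
  by rewrite addrAC subrr add0r.
by have -> : p + o - q = o - (q - p) by rewrite opprB addrA [o + p]addrC.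
Qed.

Lemma shared_edge_link W p q x y : cell W p -> cell W q -> p != q ->
  grid_adj x y -> in_cell x p -> in_cell y p -> in_cell x q -> in_cell y q ->
  link W p q.
Proof.
move=> cp cq pq; rewrite /link cp cq grid_adjE !dirsE !in_cellE.
move: pq; case: p q x y {cp cq} => [? ?] [? ?] [? ?] [? ?] /=.
by rewrite xpair_eqE; move=> *; apply/orP; left; lia.
Qed.

Lemma in_cell_adj p x y :
  in_cell x p -> in_cell y p -> color x != color y -> grid_adj x y.
Proof.
rewrite grid_adjE dirsE !in_cellE /color.
by case: p x y => [? ?] [? ?] [? ?] /=; lia.
Qed.

(** Two corners of a cell are equal, adjacent or opposite; opposite ones have a common neighbor [z]
    in the cell. *)
Lemma in_cell_const (k : int * int -> bool) p :
  (forall x y, in_cell x p -> in_cell y p -> grid_adj x y -> k x = k y) ->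
  forall x y, in_cell x p -> in_cell y p -> k x = k y.
Proof.
move=> kadj x y xp yp; have [|ne] := boolP (color x != color y).
  by move/(in_cell_adj xp yp); apply: kadj.
have [-> //|xy] := eqVneq x y; pose z := (x.1, y.2).
have zp : in_cell z p.
  by move: xp yp; rewrite !in_cellE /=; lia.
have zx : color x != color z.
  move: xp yp ne xy; rewrite !in_cellE /color /z.
  case: x y p {z zp kadj} => [? ?] [? ?] [? ?].
  by rewrite xpair_eqE /=; lia.
have zy : color z != color y by move: ne zx; do 3 case: color.
by rewrite (kadj x z) ?(kadj z y) //; apply: in_cell_adj; eassumption.
Qed.

Lemma cells_at_vertex W v s : pattern_free W ->
  uniq s -> all (cell W) s -> all (in_cell v) s -> (size s <= 3)%N.
Proof.
move=> free us /allP cs /allP vs; rewrite leqNgt; apply/negP => s4.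
pose t := [seq v - p | p <- s].
have ut : uniq t by rewrite map_inj_uniq // => p q /addrI/oppr_inj.
have sub : {subset t <= square_offsets} by move=> _ /mapP[p /vs h ->].
have sz : (size square_offsets <= size t)%N by rewrite size_map.
have [_ e] := uniq_min_size ut sub sz.
have {}e o : o \in square_offsets -> o \in t by rewrite e.
case/negP: (four_cells v free).
  have h o : o \in square_offsets -> cell W (v - o).
    by move/e => /mapP[p ps ->]; rewrite opprB addrC subrK; apply: cs.
  apply/and4P; split; first by rewrite -[v]subr0; apply: h.
  - exact: (h (1, 0)).
  - exact: (h (0, 1)).
  - exact: (h (1, 1)).
Qed.

(** * Linear order of the cells *)


Section Snake.
Variable V : {fset int * int}.
Hypothesis V_avoid : avoiding F_family (grid_graph V).
Hypothesis V_conn : connected (grid_graph V).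

Let W (o : int * int) : bool := o \in V.

Hypothesis edge_cell : forall x y, x \in V -> y \in V -> grid_adj x y ->
  exists p, [/\ cell W p, in_cell x p & in_cell y p].

Let W_free : pattern_free W. Proof. exact: avoiding_pattern_free. Qed.

Lemma cell_mem p : cell W p -> p \in V.
Proof. by move=> /andP[]; rewrite /W addr0. Qed.

Definition snake (s : seq (int * int)) : bool :=
  [&& uniq s, all (cell W) s & sorted (link W) s].

Lemma maximal_snake : exists2 s, snake s &
  forall t, ~~ snake (t :: s) /\ ~~ snake (rcons s t).
Proof.
have [N bound] : exists N, forall s : seq (int * int), snake s -> (size s <= N)%N.
  exists (size V) => s.
  by case/and3P=> us /allP cs _; apply: uniq_leq_size => // p /cs/cell_mem.
suff ext n (s : seq (int * int)) : snake s -> (N - size s < n)%N -> exists2 s, snake s &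
    forall t, ~~ snake (t :: s) /\ ~~ snake (rcons s t).
  exact: (ext (N - 0).+1 [::]).
elim: n s => // n IH s sn lt.
have [/hasP[t _ /orP[st|st]]|/hasPn h] :=
    boolP (has (fun t => snake (t :: s) || snake (rcons s t)) V).
- by apply: (IH _ st); have := bound _ st; rewrite /=; lia.
- by apply: (IH _ st); have := bound _ st; rewrite size_rcons; lia.
- exists s => // t; have [/h/norP //|tV] := boolP (t \in V).
  split; apply: contra tV => /and3P[_ /allP cs _]; apply/cell_mem/cs.
    by rewrite mem_head.
  by rewrite mem_rcons mem_head.
Qed.

(** An inner cell of a snake is already linked to its predecessor and its successor, and degree two
    leaves no room for [t]. *)
Lemma link_nth_degree (s : seq (int * int)) i t :
  snake s -> (0 < i)%N -> (i.+1 < size s)%N ->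
  link W (nth 0 s i) t -> t != nth 0 s i.-1 -> t != nth 0 s i.+1 -> False.
Proof.
move=> /and3P[us _ /(sortedP 0) ls] i0 i1 lt n1 n2.
have := @link_degree W (nth 0 s i) [:: t; nth 0 s i.-1; nth 0 s i.+1] W_free.
have lt1 : (i.-1 < size s)%N by lia.
have neq : (i.-1 == i.+1) = false by lia.
have := ls i.-1; rewrite prednK // => /(_ (ltnW i1)); rewrite link_sym => l1.
rewrite /= !inE nth_uniq // negb_or n1 n2 neq lt l1 (ls _ i1).
by move/(_ isT isT).
Qed.

Lemma snake_link_nth (s : seq (int * int)) i j : snake s -> (i < j)%N -> (j < size s)%N ->
  link W (nth 0 s i) (nth 0 s j) -> j = i.+1 \/ i = 0%N /\ j.+1 = size s.
Proof.
move=> sn ij js l; have [->|ji] := eqVneq j i.+1; [by left | right].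
have us : uniq s by case/and3P: sn.
have ne a b : (a < size s)%N -> (b < size s)%N -> a != b -> nth 0 s a != nth 0 s b.
  by move=> ? ?; rewrite nth_uniq.
case: (posnP i) => [i0|i0]; last first.
  by case: (link_nth_degree sn i0 _ l); [|apply: ne|apply: ne]; lia.
split=> //; apply/eqP; case: eqP => // jn.
rewrite link_sym in l.
by case: (@link_nth_degree s j _ sn _ _ l); [| |apply: ne|apply: ne]; lia.
Qed.

(** A new cell linked to an end would extend the snake, and inner cells have no further links. *)
Lemma maximal_snake_closed (s : seq (int * int)) : snake s ->
  (forall t, ~~ snake (t :: s) /\ ~~ snake (rcons s t)) ->
  forall p q, p \in s -> link W p q -> q \in s.
Proof.
move=> sn mx p q ps l; apply/negPn/negP => qs.
have [us cs ls] := and3P sn.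
have cq : cell W q by case/and3P: l.
have [m1 m2] := mx q.
have is_ : (index p s < size s)%N by rewrite index_mem.
have np : nth 0 s (index p s) = p by rewrite nth_index.
have [i0|i0] := posnP (index p s).
  case/negP: m1; rewrite /snake /= qs us cq cs /=; rewrite i0 in np.
  case: s np ls {sn mx m2 us cs qs is_ ps i0} => [|x s] //= -> ls.
  by rewrite link_sym l.
have [i1|i1] := eqVneq (index p s).+1 (size s).
  case/negP: m2; rewrite /snake rcons_uniq qs us all_rcons cq cs /=.
  have {}np : nth 0 s (size s).-1 = p by rewrite -i1.
  case: s np ls {sn mx m1 us cs qs is_ ps i0 i1} => [|x s] np ls //.
  by move: np; rewrite nth_last /= rcons_path => ->; rewrite l andbT.
have {}i1 : ((index p s).+1 < size s)%N by rewrite ltn_neqAle i1.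
apply: (@link_nth_degree s (index p s) q sn i0 i1); first by rewrite np.
- apply: contraNneq qs => ->.
  by rewrite mem_nth // (leq_ltn_trans (leq_pred _) is_).
- by apply: contraNneq qs => ->; rewrite mem_nth.
Qed.

(** Being covered by the snake spreads along the paths of the connected graph: each edge lies in a
    cell, and cells meeting at a vertex are joined by at most two links. *)
Lemma closed_snake_cells (s : seq (int * int)) : snake s -> s != [::] ->
  (forall p q, p \in s -> link W p q -> q \in s) ->
  forall p, cell W p -> p \in s.
Proof.
move=> sn s0 cl; have [_ /allP cs _] := and3P sn.
have at_vertex v p q : p \in s -> in_cell v p -> cell W q -> in_cell v q -> q \in s.
  move=> ps vp cq vq; have [<- //|pq] := eqVneq p q.
  have [l|[r [_ l1 l2]]] := linked_at_vertex (cs _ ps) cq vp vq pq.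
    exact: cl l.
  exact: (cl _ _ (cl _ _ ps l1) l2).
case: s s0 sn cl cs at_vertex => // p0 s _ sn cl cs at_vertex.
have corner p : in_cell p p by rewrite /in_cell subrr.
pose A (v : V) := has (in_cell (val v)) (p0 :: s).
have p0V : p0 \in V by apply: cell_mem; apply: cs; rewrite mem_head.
have Apath q (x : V) : A x -> path (@grid_edge V) x q -> A (last x q).
  elim: q x => //= y q IH x /hasP[p ps xp] /andP[xy]; apply: IH.
  have [r [cr xr yr]] := edge_cell (fsvalP x) (fsvalP y) xy.
  by apply/hasP; exists r => //; apply: (at_vertex (val x) p).
move=> p cp; have pV := cell_mem cp.
have /connectP[q pq e] := V_conn [` p0V]%fset [` pV]%fset.
have : A (last [` p0V]%fset q).
  by apply: Apath pq; apply/hasP; exists p0; rewrite ?mem_head.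
by rewrite -e => /hasP[r rs pr]; apply: (at_vertex p r).
Qed.

(* Lifting vertices to the universal cover of a closed-up snake yields a cocycle;
   the level of a vertex shared by the last and the first cell is 1 when it is
   seen from the beginning of the snake. *)
Lemma snake_not_closed (s : seq (int * int)) : snake s -> (2 < size s)%N ->
  (forall p, cell W p -> p \in s) ->
  ~~ link W (nth 0 s 0) (nth 0 s (size s).-1).
Proof.
move=> sn s2 cover; apply/negP => lclose.
have [us /allP cs /(sortedP 0) ls] := and3P sn.
set m := size s in s2 lclose *.
have m3 : (3 < m)%N.
  rewrite ltn_neqAle s2 andbT; apply/eqP => e.
  have := link_triangle (ls 0%N (ltn_trans (isT : 1 < 2)%N s2)) (ls 1%N s2).
  by move: lclose; rewrite -e => ->.
have cn i : (i < m)%N -> cell W (nth 0 s i) by move=> im; apply/cs/mem_nth.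
pose straddle v := in_cell v (nth 0 s 0) && in_cell v (nth 0 s m.-1).
(* A straddling vertex may also lie in cell 1, so cells 0 and 1 both count as the beginning. It
   cannot lie in cells 1 and 2 together, since it would then be in four cells; so the drop after
   index 1 is never seen at a vertex of both. *)
pose lev v i := straddle v && (i <= 1)%N.
have not_12 v : in_cell v (nth 0 s 1) -> in_cell v (nth 0 s 2) -> straddle v = false.
  move=> v1 v2; apply/negP => /andP[v0 vm].
  have := @cells_at_vertex W v [seq nth 0 s i | i <- [:: 0; 1; 2; m.-1]%N] W_free.
  have -> : uniq [seq nth 0 s i | i <- [:: 0; 1; 2; m.-1]%N].
    rewrite /= !inE !nth_uniq -/m //=; try lia.
  by move/(_ isT); rewrite /= !cn ?v0 ?v1 ?v2 ?vm; try lia; move/(_ isT isT).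
(* Two cells sharing an edge are consecutive, or the first and the last. In the latter case both
   endpoints straddle, and their levels change together. *)
have lev_edge x y i j : (i < j)%N -> (j < m)%N -> grid_adj x y ->
    in_cell x (nth 0 s i) -> in_cell y (nth 0 s i) ->
    in_cell x (nth 0 s j) -> in_cell y (nth 0 s j) ->
    lev x i (+) lev y i = lev x j (+) lev y j.
  move=> ij jm xy xi yi xj yj; have im : (i < m)%N by lia.
  have ne : nth 0 s i != nth 0 s j by rewrite nth_uniq // neq_ltn ij.
  have l := shared_edge_link (cn _ im) (cn _ jm) ne xy xi yi xj yj.
  rewrite /lev; have [ej|[i0 ej]] := snake_link_nth sn ij jm l; last first.
    have jm1 : j = m.-1 by rewrite /m -ej.
    rewrite i0 in xi yi; rewrite jm1 in xj yj.
    by rewrite /straddle xi yi xj yj !addbb.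
  have [e1|ne1] := eqVneq i 1%N.
    by subst i; subst j; rewrite !not_12.
  by have -> : (j <= 1)%N = (i <= 1)%N by lia.
pose phi x y := has (fun i => [&& in_cell x (nth 0 s i), in_cell y (nth 0 s i)
                                & lev x i (+) lev y i]) (iota 0 m).
have phiE x y i : grid_adj x y -> (i < m)%N ->
    in_cell x (nth 0 s i) -> in_cell y (nth 0 s i) -> phi x y = lev x i (+) lev y i.
  move=> xy im xi yi; apply/hasP/idP => [[j]|h]; last first.
    by exists i; rewrite ?mem_iota // xi yi.
  rewrite mem_iota add0n => /= jm /and3P[xj yj].
  case: (ltngtP i j) => [ij|ji|->] //.
  - by rewrite (lev_edge x y i j).
  - by rewrite (lev_edge x y j i).
have phi_sym x y : phi x y = phi y x.
  by apply: eq_has => i; rewrite addbC andbCA.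
have phi_square a b c d : {subset [:: a; b; c; d] <= V} ->
    cycle grid_adj [:: a; b; c; d] -> a != c -> b != d ->
    cycle_weight phi [:: a; b; c; d] = false.
  move=> sV cyc ac bd; have [q qE] := cycle4_square cyc ac bd.
  have cq : cell W q by apply/allP => o oS; apply: sV; rewrite qE map_f.
  have qs := cover _ cq; have im : (index q s < m)%N by rewrite index_mem.
  have nq : nth 0 s (index q s) = q by rewrite nth_index.
  have inq z : z \in [:: a; b; c; d] -> in_cell z (nth 0 s (index q s)).
    by rewrite qE nq => /mapP[o oS ->]; rewrite /in_cell addrAC subrr add0r.
  have [ia ib ic id] : [/\ in_cell a (nth 0 s (index q s)),
    in_cell b (nth 0 s (index q s)), in_cell c (nth 0 s (index q s))
    & in_cell d (nth 0 s (index q s))].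
    by split; apply: inq; rewrite !inE eqxx ?orbT.
  move: cyc => /= /and5P[ab bc cd da _].
  rewrite (phiE _ _ _ ab im) // (phiE _ _ _ bc im) // (phiE _ _ _ cd im) //.
  rewrite (phiE _ _ _ da im) //.
  by do 4 case: (lev _ _).
have [g gE] := cocycle_coboundary V_avoid phi_sym phi_square V_conn.
(* On cell [i] both [g] and the level have coboundary [phi], so [k i] is constant there, and the
   constant is passed on along the snake. At a vertex common to the first and the last cell,
   however, the two levels differ. *)
pose k i x := g x (+) lev x i.
have inV x i : (i < m)%N -> in_cell x (nth 0 s i) -> x \in V.
  by move=> im; apply: cell_in (cn _ im).
have kconst i x y : (i < m)%N -> in_cell x (nth 0 s i) -> in_cell y (nth 0 s i) ->
    k i x = k i y.
  move=> im; move: x y; apply: in_cell_const => x y xi yi xy.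
  have := gE x y (inV _ _ im xi) (inV _ _ im yi) xy.
  rewrite (phiE _ _ _ xy im xi yi) /k.
  by case: (lev x i) (lev y i) (g x) (g y) => [] [] [] [].
have corner i : in_cell (nth 0 s i) (nth 0 s i) by rewrite /in_cell subrr.
have kstep i : (i.+1 < m)%N -> k i (nth 0 s i) = k i.+1 (nth 0 s i.+1).
  move=> im; have im' : (i < m)%N by lia.
  have [v vi vi1] := link_common_vertex (ls _ im).
  rewrite (kconst i _ v) // (kconst i.+1 _ v) // /k /lev; congr (_ (+) _).
  have [e1|ne1] := eqVneq i 1%N; first by subst i; rewrite not_12.
  by have -> : (i < 1)%N = (i <= 1)%N by lia.
have k0 i : (i < m)%N -> k i (nth 0 s i) = k 0%N (nth 0 s 0).
  elim: i => // i IH im; rewrite -kstep //; apply: IH; lia.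
have [v v0 vm] := link_common_vertex lclose.
have lt : (m.-1 < m)%N by lia.
have := k0 _ lt; rewrite (kconst m.-1 _ v) // (kconst 0%N _ v) //; last by lia.
rewrite /k /lev /straddle v0 vm /=; have -> : (m.-1 <= 1)%N = false by lia.
by case: (g v).
Qed.

(** Links join only consecutive positions once the snake does not close up. Two cells at [v] are
    linked or have a common linked cell at [v]; so their positions differ by at most two, and a
    position strictly between is that of the common cell. *)
Lemma cell_order : exists2 s : seq (int * int), cell W =1 (mem s) &
  forall v i j l, (i <= j <= l)%N -> (l < size s)%N ->
    in_cell v (nth 0 s i) -> in_cell v (nth 0 s l) -> in_cell v (nth 0 s j).
Proof.
have [s sn mx] := maximal_snake; have [us /allP cs /(sortedP 0) ls] := and3P sn.
have [s0|s0] := eqVneq s [::].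
  exists s; last by rewrite s0.
  move=> p; rewrite s0 [RHS]/=; apply/negP => cp.
  by case: (mx p) => /negP[]; rewrite s0 /snake /= cp.
have cover := closed_snake_cells sn s0 (maximal_snake_closed sn mx).
exists s; first by move=> p; apply/idP/idP => [/cover|/cs].
have consec i j : (i < j)%N -> (j < size s)%N ->
    link W (nth 0 s i) (nth 0 s j) -> j = i.+1.
  move=> ij js l; have [//|[i0 jm]] := snake_link_nth sn ij js l.
  have [s2|] := leqP (size s) 2; first by lia.
  move=> s2; have := snake_not_closed sn s2 cover.
  by rewrite -jm /= -{1}i0 l.
have dist i j : (i < size s)%N -> (j < size s)%N ->
    link W (nth 0 s i) (nth 0 s j) -> (j <= i.+1)%N && (i <= j.+1)%N.
  move=> im jm; case: (ltngtP i j) => [ij l|ij l|->]; last by lia.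
    by have := consec _ _ ij jm l; lia.
  by rewrite link_sym in l; have := consec _ _ ij im l; lia.
move=> v i j l /andP[ij jl] lm vi vl.
have [<- //|nij] := eqVneq i j.
have [-> //|njl] := eqVneq j l.
have im : (i < size s)%N by lia.
have ne : nth 0 s i != nth 0 s l by rewrite nth_uniq //; lia.
have [lk|[r [vr l1 l2]]] :=
  linked_at_vertex (cs _ (mem_nth 0 im)) (cs _ (mem_nth 0 lm)) vi vl ne.
  by have := dist _ _ im lm lk; lia.
have rs : r \in s by apply: cover; case/and3P: l1.
have rm : (index r s < size s)%N by rewrite index_mem.
rewrite -(nth_index 0 rs) in l1 l2 vr.
have := dist _ _ im rm l1; have := dist _ _ rm lm l2 => h1 h2.
by have -> : j = index r s by lia.
Qed.

End Snake.

(** * From the order of the cells to the equivalence *)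

Lemma in_unit_square v p : (v \in unit_square p) = in_cell v p.
Proof.
rewrite in_cellE /unit_square !inE; case: v p => [? ?] [? ?].
by rewrite !xpair_eqE /=; lia.
Qed.

Lemma unit_square_cell (V : {fset int * int}) p :
  (unit_square p `<=` V)%fset -> cell (fun o => o \in V) p.
Proof.
move=> /fsubsetP sub; apply/allP => o oS; apply: sub.
by rewrite in_unit_square /in_cell addrAC subrr add0r.
Qed.

(** Each vertex gets its parity as side and the span of the positions of its cells as interval. *)
Lemma avoiding_representable12 (V : {fset int * int}) :
  square_grid_graph V -> avoiding F_family (grid_graph V) ->
  representable12 (grid_graph V).
Proof.
case=> conn vsq esq avo.
have edge_cell x y : x \in V -> y \in V -> grid_adj x y ->
    exists p, [/\ cell (fun o => o \in V) p, in_cell x p & in_cell y p].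
  move=> xV yV /(esq _ _ xV yV)[Q [sub [p e]]]; rewrite e in sub *.
  rewrite !in_unit_square => /andP[xp yp]; exists p; split=> //.
  exact: unit_square_cell.
have [s cellE convex] := cell_order avo conn edge_cell.
have H (x : grid_graph V) : exists i, (i < size s)%N && in_cell (val x) (nth 0 s i).
  have [Q [sub [p e]]] := vsq _ (fsvalP x); rewrite e in sub *.
  rewrite in_unit_square => xp.
  have ps : p \in s by move: (unit_square_cell sub); rewrite cellE.
  by exists (index p s); rewrite index_mem ps nth_index.
have bnd (x : grid_graph V) i : (i < size s)%N && in_cell (val x) (nth 0 s i) ->
    (i <= size s)%N by case/andP=> /ltnW.
apply: (@interval_bigraph_representable12 _ (fun x : grid_graph V => color (val x))
  (fun x => ex_minn (H x)) (fun x => ex_maxn (H x) (bnd x))) => x y.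
case: ex_minnP => ax /andP[axs hax] minx; case: ex_maxnP => y1 /andP[y1s hy1] maxy.
case: ex_minnP => ay /andP[ays hay] miny; case: ex_maxnP => x1 /andP[x1s hx1] maxx.
apply/idP/and3P => [xy|[cxy axy ayx]].
- have [p [cp xp yp]] := edge_cell _ _ (fsvalP x) (fsvalP y) xy.
  have ps : p \in s by move: cp; rewrite cellE.
  have ip : (index p s < size s)%N by rewrite index_mem.
  have hx : (index p s < size s)%N && in_cell (val x) (nth 0 s (index p s)).
    by rewrite ip nth_index.
  have hy : (index p s < size s)%N && in_cell (val y) (nth 0 s (index p s)).
    by rewrite ip nth_index.
  split; first by rewrite (grid_adj_color xy); case: color.
  + exact: leq_trans (minx _ hx) (maxy _ hy).
  + exact: leq_trans (miny _ hy) (maxx _ hx).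
(* If the intervals meet, the cell at the larger left end contains both vertices by convexity, and
   vertices of different color in one cell are adjacent. *)
- case: (leqP ax ay) => [le|/ltnW le].
  + apply: (@in_cell_adj (nth 0 s ay)) => //.
    by apply: (convex _ ax ay x1) => //; rewrite le.
  + apply: (@in_cell_adj (nth 0 s ax)) => //.
    by apply: (convex _ ay ax y1) => //; rewrite le.
Qed.

Theorem theorem18 (V : {fset int * int}) :
  square_grid_graph V ->
  (avoiding F_family (grid_graph V) <-> representable12 (grid_graph V)).
Proof.
move=> sq; split; first exact: avoiding_representable12.
exact: representable12_avoiding.
Qed.
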